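(* For integers $n \ge 1$, $$C_n = \binom{2n}{n}\left(\zeta(s) - \sum_{i=1}^{n}\frac{1}{i^{s}} - \sum_{i=n+2}^{\infty}\frac{1}{i^{s}}\right)^{1/s}.$$
   Context: $C_n = \frac{1}{n+1}\binom{2n}{n}$ is the $n$-th Catalan number, and $\binom{2n}{n}$ is the central binomial coefficient. $\zeta$ is the Riemann zeta function, written as the series $\zeta(s)=\sum_{i=1}^{\infty} \frac{1}{i^{s}}$, and $s$ is its complex argument.
   Formalization: For Re s > 1 the identity is stated for some value of the multivalued 1/s-th power, and for the principal value when −Im(s) ln(n+1) lies in (−π, π] (so for all real s > 1); with the principal value it fails otherwise, e.g. n = 1, s = 2+10i. *)

(* Defs.v *)
From Stdlib Require Import Reals.
From Coquelicot Require Import Coquelicot.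
Open Scope R_scope.

Definition central_binomial (n : nat) : R := Binomial.C (2 * n) n.

Definition catalan (n : nat) : R := 1 / INR (n + 1) * central_binomial n.

Definition Cexp (z : C) : C := (exp (Re z) * cos (Im z), exp (Re z) * sin (Im z)).

(* Principal argument, in (-PI, PI]; the value at 0 is irrelevant. *)
Definition Carg (z : C) : R :=
  if Rle_dec 0 (Im z) then acos (Re z / Cmod z) else - acos (Re z / Cmod z).

Definition Clog (z : C) : C := (ln (Cmod z), Carg z).

(* Principal value of the power z ^ w, for z <> 0. For real z > 0, [Clog z] is
   the real logarithm, so that i ^ s = exp (s * ln i) for integers i >= 1. *)
Definition Cpower (z w : C) : C := Cexp (w * Clog z)%C.

(* [is_Cpower z w v]: v is one of the values of the multivalued power z ^ w,
   obtained from some logarithm of z. *)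
Definition is_Cpower (z w v : C) : Prop :=
  exists l : C, Cexp l = z /\ v = Cexp (w * l)%C.

(* Coquelicot's [Series] is limited to real terms; this is its complex version
   (meaningful when the series converges, see [Csum_unique]). *)
Definition Csum (a : nat -> C) : C :=
  iota (T := C_R_CompleteNormedModule)
    (is_series (V := C_R_CompleteNormedModule) a).

Lemma Csum_unique (a : nat -> C) (l : C) :
  is_series (V := C_R_CompleteNormedModule) a l -> Csum a = l.
Proof.
intros H.
exact (iota_filterlim_locally (V := C_R_CompleteNormedModule) _ _ H).
Qed.

Definition zeta_term (s : C) (i : nat) : C := (1 / Cpower (RtoC (INR i)) s)%C.

Definition sum_range (a : nat -> C) (m n : nat) : C :=
  sum_n_m (G := C_AbelianMonoid) a m n.

(* Sum of a i over all i >= m. *)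
Definition sum_from (a : nat -> C) (m : nat) : C := Csum (fun k => a (m + k)%nat).

(* The Dirichlet series, convergent for Re s > 1. *)
Definition zeta (s : C) : C := sum_from (zeta_term s) 1.

(* Main.v *)
(** Dropping the first [n] terms and the terms from [n + 2] on leaves
    [w = (n + 1)^(-s) = Cexp (- s * ln (n + 1))].  The logarithm
    [- s * ln (n + 1)] of [w] yields the value [1 / (n + 1)] of [w^(1/s)]; it is
    the principal one when its imaginary part lies in [(-PI, PI]]. *)

Require Import Defs.
From Stdlib Require Import Reals Lra Lia.
From Coquelicot Require Import Coquelicot.
Open Scope R_scope.

Lemma ln_le_minus_1 (x : R) : 0 < x -> ln x <= x - 1.
Proof.
intros Hx.
pose proof (exp_ineq1_le (ln x)) as H.
rewrite exp_ln in H by assumption; lra.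
Qed.

(* Discrete form of the integral test:
   [(p - 1) x^(-p) <= (x - 1)^(1 - p) - x^(1 - p)]. *)
Lemma Rpower_telescope_le (p y : R) : 1 < p -> 0 < y ->
  (p - 1) * Rpower (y + 1) (- p) <= Rpower y (1 - p) - Rpower (y + 1) (1 - p).
Proof.
intros Hp Hy.
(* This is [ln t <= t - 1] at [t = y / (y + 1)], where [t - 1 = - / (y + 1)]. *)
assert (Hln : ln y - ln (y + 1) <= - / (y + 1)).
{ rewrite <- ln_div by lra.
  replace (- / (y + 1)) with (y / (y + 1) - 1) by (field; lra).
  apply ln_le_minus_1, Rdiv_lt_0_compat; lra. }
assert (Hx : Rpower (y + 1) (- p) = Rpower (y + 1) (1 - p) * / (y + 1)).
{ replace (- p) with ((1 - p) + - (1)) by ring.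
  rewrite Rpower_plus, Rpower_Ropp, Rpower_1 by lra; reflexivity. }
assert (Hyx : Rpower y (1 - p)
  = Rpower (y + 1) (1 - p) * exp ((p - 1) * (ln (y + 1) - ln y))).
{ unfold Rpower; rewrite <- exp_plus; f_equal; ring. }
assert (Hexp : 1 + (p - 1) * / (y + 1) <= exp ((p - 1) * (ln (y + 1) - ln y))).
{ eapply Rle_trans; [| apply exp_ineq1_le].
  apply Rplus_le_compat_l, Rmult_le_compat_l; lra. }
assert (H0 : 0 < Rpower (y + 1) (1 - p)) by apply exp_pos.
rewrite Hx, Hyx.
apply (Rmult_le_compat_l _ _ _ (Rlt_le _ _ H0)) in Hexp; lra.
Qed.

(** The partial sums increase, and telescoping keeps them below [p / (p - 1)]. *)
Lemma ex_series_Rpower (p : R) : 1 < p ->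
  ex_series (fun k => Rpower (INR (S k)) (- p)).
Proof.
intros Hp.
set (a := fun k => Rpower (INR (S k)) (- p)).
assert (Hone : forall z, Rpower (INR 1) z = 1).
{ intros z; unfold Rpower; simpl; rewrite ln_1, Rmult_0_r; apply exp_0. }
(* The first [p - 1] accounts for the term [k = 0], which equals 1; the bracket is the telescoped
   bound for the remaining terms. *)
assert (Hsum : forall n,
  (p - 1) * sum_n a n <= (p - 1) + (1 - Rpower (INR (S n)) (1 - p))).
{ induction n as [|n IH].
  - rewrite sum_O; unfold a; rewrite !Hone; lra.
  - rewrite sum_Sn; change plus with Rplus; unfold a at 2.
    pose proof (Rpower_telescope_le p (INR (S n)) Hp
                  (lt_0_INR _ (Nat.lt_0_succ n))) as H.
    rewrite <- S_INR in H; lra. }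
destruct (ex_finite_lim_seq_incr (sum_n a) (p / (p - 1))) as [l Hl].
- intros n; rewrite sum_Sn; change plus with Rplus.
  pose proof (exp_pos (- p * ln (INR (S (S n))))) as H.
  unfold a at 3, Rpower; lra.
- intros n; apply Rmult_le_reg_l with (p - 1); [lra|].
  replace ((p - 1) * (p / (p - 1))) with p by (field; lra).
  pose proof (Hsum n).
  pose proof (exp_pos ((1 - p) * ln (INR (S n)))) as H0.
  fold (Rpower (INR (S n)) (1 - p)) in H0; lra.
- exists l; exact Hl.
Qed.

Lemma Cexp_add (x y : C) : Cexp (x + y)%C = (Cexp x * Cexp y)%C.
Proof.
destruct x as [a b], y as [c d]; unfold Cexp, Cplus, Cmult, Re, Im; simpl.
rewrite exp_plus, cos_plus, sin_plus; f_equal; ring.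
Qed.

Lemma Cexp_RtoC (x : R) : Cexp (RtoC x) = RtoC (exp x).
Proof.
unfold Cexp, RtoC, Re, Im; simpl.
rewrite cos_0, sin_0; f_equal; ring.
Qed.

Lemma Cmod_Cexp (z : C) : Cmod (Cexp z) = exp (Re z).
Proof.
pose proof (sin2_cos2 (Im z)) as H; unfold Rsqr in H.
unfold Cmod; simpl.
transitivity (sqrt (exp (Re z) * exp (Re z)));
  [f_equal | apply sqrt_square; left; apply exp_pos].
transitivity (exp (Re z) * exp (Re z)
  * (sin (Im z) * sin (Im z) + cos (Im z) * cos (Im z))); [ring|].
rewrite H; ring.
Qed.

Lemma Cexp_neq_0 (z : C) : Cexp z <> RtoC 0.
Proof.
apply Cmod_gt_0; rewrite Cmod_Cexp; apply exp_pos.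
Qed.

Lemma Cexp_opp (z : C) : Cexp (- z)%C = (1 / Cexp z)%C.
Proof.
assert (H : (Cexp (- z) * Cexp z)%C = RtoC 1).
{ rewrite <- Cexp_add, Cplus_comm, Cplus_opp_r, Cexp_RtoC, exp_0; reflexivity. }
rewrite <- H; field; apply Cexp_neq_0.
Qed.

(** On this strip the argument of [Cexp z] is [Im z] itself, with no multiple of [2 * PI] to
    subtract. *)
Lemma Clog_Cexp (z : C) : - PI < Im z <= PI -> Clog (Cexp z) = z.
Proof.
intros [Hlo Hhi].
pose proof (exp_pos (Re z)) as He.
unfold Clog; rewrite Cmod_Cexp, ln_exp.
rewrite (surjective_pairing z) at 3; f_equal; change (snd z) with (Im z).
unfold Carg; rewrite Cmod_Cexp.
change (Re (Cexp z)) with (exp (Re z) * cos (Im z)).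
change (Im (Cexp z)) with (exp (Re z) * sin (Im z)).
replace (exp (Re z) * cos (Im z) / exp (Re z)) with (cos (Im z)) by (field; lra).
(* [Carg] tests the sign of the sine, which on the strip is nonnegative exactly when [Im z] is, so
   the two mixed cases are contradictory. At the excluded end [- PI] the sine vanishes and [Carg]
   would return [PI]. *)
destruct (Rle_or_lt 0 (Im z)) as [Hz | Hz];
  destruct (Rle_dec 0 (exp (Re z) * sin (Im z))) as [Hs | Hs].
- apply acos_cos; lra.
- elim Hs; apply Rmult_le_pos; [lra|]; apply sin_ge_0; lra.
- assert (0 < sin (- Im z)) by (apply sin_gt_0; lra).
  rewrite sin_neg in *; nra.
- rewrite <- cos_neg, acos_cos by lra; ring.
Qed.

Lemma zeta_term_Cexp (s : C) (i : nat) : (0 < i)%nat ->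
  zeta_term s i = Cexp (- (s * RtoC (ln (INR i))))%C.
Proof.
intros Hi; unfold zeta_term, Cpower.
assert (Hlog : Clog (RtoC (INR i)) = RtoC (ln (INR i))).
(* Seen as [Cexp] of the real number [ln i], the base has a logarithm with imaginary part 0, inside
   the strip. *)
{ rewrite <- (exp_ln (INR i)) at 1 by (apply lt_0_INR, Hi).
  rewrite <- Cexp_RtoC; apply Clog_Cexp; simpl.
  pose proof PI_RGT_0; lra. }
rewrite Hlog, Cexp_opp; reflexivity.
Qed.

(** Absolute convergence: the modulus of [i^(-s)] is [i^(- Re s)], since [ln i] is real. *)
Lemma ex_series_zeta_term (s : C) : 1 < Re s ->
  ex_series (V := C_R_CompleteNormedModule) (fun k => zeta_term s (1 + k)).
Proof.
intros Hs.
apply ex_series_le with (2 := ex_series_Rpower (Re s) Hs).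
intros k; right.
rewrite zeta_term_Cexp by lia.
transitivity (Cmod (Cexp (- (s * RtoC (ln (INR (1 + k)))))%C)); [symmetry; apply Cmod_norm|].
rewrite Cmod_Cexp; unfold Rpower; f_equal.
change (1 + k)%nat with (S k).
destruct s as [a b]; unfold Re; simpl; ring.
Qed.

(** [Csum] is known only through a proof of convergence, so a limit [l] of the tail is obtained
    first and the whole series is then rebuilt from it. *)
Lemma sum_from_split (a : nat -> C) (n : nat) :
  ex_series (V := C_R_CompleteNormedModule) (fun k => a (1 + k)%nat) ->
  sum_from a 1
  = (sum_range a 1 n + a (n + 1)%nat + sum_from a (n + 2))%C.
Proof.
intros Hex.
pose proof Hex as Htail.
(* The series starts at [a 1], so removing [S n] terms takes away [a 1] to [a (n + 1)]. *)
apply (ex_series_incr_n (V := C_R_CompleteNormedModule) _ (S n)) in Htail.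
destruct Htail as [l Hl].
assert (Htail : sum_from a (n + 2) = l).
{ apply Csum_unique.
  apply (is_series_ext (V := C_R_CompleteNormedModule)) with (2 := Hl).
  intros k; f_equal; lia. }
rewrite Htail; apply Csum_unique.
(* It remains to see that the tail limit [l] is the claimed total minus these [S n] terms. *)
apply (is_series_decr_n (V := C_R_CompleteNormedModule) _ (S n)); [lia|].
replace (plus (G := C_R_CompleteNormedModule) _ _) with l; [exact Hl|].
assert (Hsum : sum_n (G := C_R_CompleteNormedModule)
    (fun k => a (1 + k)%nat) (Init.Nat.pred (S n))
  = (sum_range a 1 n + a (n + 1)%nat)%C).
{ unfold sum_n, sum_range; simpl Init.Nat.pred.
  etransitivity; [apply (sum_n_m_S (G := C_R_CompleteNormedModule) a 0 n)|].
  etransitivity; [apply (sum_n_Sm (G := C_R_CompleteNormedModule)); lia|].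
  rewrite Nat.add_1_r; reflexivity. }
assert (Hcancel : forall x y : C, x = (y + x + - y)%C) by (intros; ring).
change (l = (sum_range a 1 n + a (n + 1)%nat + l
  + - sum_n (G := C_R_CompleteNormedModule)
        (fun k => a (1 + k)%nat) (Init.Nat.pred (S n)))%C).
rewrite Hsum; apply Hcancel.
Qed.

Theorem proposition2 :
  forall (n : nat) (s : C), (1 <= n)%nat -> 1 < Re s ->
  let w : C :=
    (zeta s - sum_range (zeta_term s) 1 n - sum_from (zeta_term s) (n + 2))%C in
  (exists v : C, is_Cpower w (1 / s)%C v /\
     RtoC (catalan n) = (RtoC (central_binomial n) * v)%C)
  /\
  (- PI < - (Im s * ln (INR (n + 1))) <= PI ->
     RtoC (catalan n) = (RtoC (central_binomial n) * Cpower w (1 / s))%C).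
Proof.
intros n s _ Hs w.
set (L := ln (INR (n + 1))).
assert (Hw : w = Cexp (- (s * RtoC L))%C).
{ unfold L; rewrite <- zeta_term_Cexp by lia.
  unfold w, zeta; rewrite (sum_from_split _ n) by (apply ex_series_zeta_term, Hs).
  ring. }
assert (Hs0 : s <> RtoC 0) by (intros ->; simpl in Hs; lra).
assert (HN : 0 < INR (n + 1)) by (apply lt_0_INR; lia).
assert (Hcat : RtoC (catalan n)
  = (RtoC (central_binomial n) * Cexp (1 / s * - (s * RtoC L)))%C).
(* Cancelling [s], nonzero as [Re s > 1], leaves [- ln (n + 1)], whose exponential is the factor
   [1 / (n + 1)] of [catalan]. *)
{ replace (1 / s * - (s * RtoC L))%C with (RtoC (- L)).
  - rewrite Cexp_RtoC, exp_Ropp; unfold L; rewrite exp_ln by exact HN.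
    rewrite <- RtoC_mult; f_equal; unfold catalan; field; lra.
  - rewrite RtoC_opp; field; exact Hs0. }
split.
- exists (Cexp (1 / s * - (s * RtoC L))%C); split; [|exact Hcat].
  exists (- (s * RtoC L))%C; split; [symmetry; exact Hw | reflexivity].
(* The hypothesis puts [- s * L] in the strip of [Clog_Cexp], so [Clog w] is this very logarithm. *)
- intros Him; rewrite Hcat; unfold Cpower; rewrite Hw, Clog_Cexp; [reflexivity|].
  replace (Im (- (s * RtoC L))%C) with (- (Im s * L)); [exact Him|].
  destruct s as [a b]; unfold Im; simpl; ring.
Qed.
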